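(* Let $\lambda$ be a nonempty partition with $\ell$ parts and largest part $\lambda_1$, and let $w_0w_1\cdots w_{L-1}$, $L=\lambda_1+\ell$, be its profile word in the letters $E$ (east step) and $N$ (north step). Let $s$ be a positive integer with $s<L$ such that (i) among the letters $w_0,\dots,w_{L-s-1}$ there are strictly more $E$'s than $N$'s, and (ii) among the letters $w_s,\dots,w_{L-1}$ there are strictly more $N$'s than $E$'s. Then $s\in Hk(\lambda)$. Consequently, if $\{s_i\}$ is any set of positive integers each of which satisfies (i) and (ii), then $\{s_i\}\subseteq Hk(\lambda)$.
   Context: For a partition $\lambda=(\lambda_1\ge\dots\ge\lambda_\ell\ge1)$, the hook length of cell $(i,j)$ ($1\le i\le \ell$, $1\le j\le\lambda_i$) is $h_{ij}=\lambda_i-j+\lambda'_j-i+1$ with $\lambda'_j=|\{a:\lambda_a\ge j\}|$, and $Hk(\lambda)$ is the set of all hook lengths. The profile of $\lambda$ is the lattice path along the outer (southmost and eastmost) boundary of its Young diagram (drawn in English notation, rows top to bottom), traversed from the bottom-left corner to the top-right corner; it consists of $\lambda_1$ east steps $E$ and $\ell$ north steps $N$, begins with $E$ and ends with $N$. Reading it gives the word $w_0\cdots w_{L-1}$, and the hook lengths of $\lambda$ are exactly the numbers $q-p$ with $p<q$, $w_p=E$, $w_q=N$. Conditions (i) and (ii) are the precise meaning of ''the profile lies strictly above the diagonal at the points at distance $s$ from the upper and from the lower corner along the profile''. *)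

(* Defs.v *)
From HB Require Import structures.
From mathcomp Require Import all_boot.
From mathcomp Require Import classical_sets.

Set Implicit Arguments.
Unset Strict Implicit.
Unset Printing Implicit Defensive.

Local Open Scope classical_set_scope.

Definition is_partition (la : seq nat) : bool :=
  sorted geq la && all (leq 1) la.

(* Rows and columns are numbered from 1, so [part la i] is meaningful for
   [1 <= i]; it is 0 past the last part. *)
Definition part (la : seq nat) (i : nat) : nat := nth 0 la i.-1.

Definition conj_part (la : seq nat) (j : nat) : nat :=
  count (fun a => j <= a) la.

Definition is_cell (la : seq nat) (i j : nat) : bool :=
  (1 <= i <= size la) && (1 <= j <= part la i).

(* On a cell of a partition, [j <= part la i] and [i <= conj_part la j], so no
   subtraction is truncated. *)
Definition hook_length (la : seq nat) (i j : nat) : nat :=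
  part la i - j + conj_part la j - i + 1.

Definition Hk (la : seq nat) : set nat :=
  [set h | exists i j, is_cell la i j /\ h = hook_length la i j].

Inductive step : Type := East | North.

Definition step_to_bool (x : step) : bool := if x is East then true else false.
Definition step_of_bool (b : bool) : step := if b then East else North.
Lemma step_to_boolK : cancel step_to_bool step_of_bool.
Proof. by case. Qed.
HB.instance Definition _ := Equality.copy step (can_type step_to_boolK).

(* The boundary path from the bottom-left to the top-right corner. The lower
   rows [la'] are walked first, ending at abscissa [head 0 la'] (0 if there are
   none); the path then goes east to abscissa [a] and up the side of the top
   row, of length [a]. *)
Fixpoint profile (la : seq nat) : seq step :=
  if la is a :: la' then
    profile la' ++ nseq (a - head 0 la') East ++ [:: North]
  else [::].

Definition profile_length (la : seq nat) : nat := part la 1 + size la.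

Lemma count_profile (la : seq nat) : is_partition la ->
  count_mem East (profile la) = part la 1 /\
  count_mem North (profile la) = size la.
Proof.
rewrite /is_partition /part /=; elim: la => [|a la IH] //= /andP[pa /andP[_ al]].
have [IE IN] : count_mem East (profile la) = nth 0 la 0 /\
               count_mem North (profile la) = size la.
  by apply: IH; rewrite al (path_sorted pa).
rewrite !count_cat !count_nseq /= IE IN mul1n mul0n !addn0 add0n addn1.
split=> //; rewrite -nth0 subnKC //.
by case: la pa {IH al IE IN} => [|b la] //= /andP[].
Qed.

Lemma size_profile (la : seq nat) : is_partition la ->
  size (profile la) = profile_length la.
Proof.
move=> /count_profile[cE cN]; rewrite /profile_length -cE -cN.
rewrite -(count_predC (pred1 East)); congr (_ + _).
by apply: eq_count; case.
Qed.

Definition more_East_in_prefix (la : seq nat) (s : nat) : bool :=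
  let u := take (profile_length la - s) (profile la) in
  count_mem North u < count_mem East u.

Definition more_North_in_suffix (la : seq nat) (s : nat) : bool :=
  let v := drop s (profile la) in
  count_mem East v < count_mem North v.

(* Main.v *)
(* Align the prefix w_0 ... w_{L-s-1} with the suffix w_s ... w_{L-1}: both have
   L - s letters. By (i) more than half of the positions p carry w_p = E and by
   (ii) more than half carry w_{p+s} = N, so some p does both, and the distance s
   between these two steps is a hook length: the E-step is the foot of a column,
   the N-step the end of a row, and they bound the hook of the cell where the
   column and the row meet. *)
Require Import Defs.
From mathcomp Require Import all_boot.
From mathcomp Require Import classical_sets.
From mathcomp Require Import zify.

Local Open Scope classical_set_scope.

Lemma is_partition_cons (a : nat) (la : seq nat) :
  is_partition (a :: la) -> is_partition la /\ all (geq a) la.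
Proof.
rewrite /is_partition /= => /andP[pa /andP[_ al]].
have geq_trans : transitive geq by move=> y x z /= yx zy; apply: leq_trans yx.
by rewrite al (path_sorted pa) (order_path_min geq_trans pa).
Qed.

Lemma part_le (a : nat) (la : seq nat) (i : nat) :
  all (geq a) la -> part la i <= a.
Proof.
rewrite /part => /allP ge_a.
have [lt_i|le_i] := ltnP i.-1 (size la); last by rewrite nth_default.
exact: ge_a (mem_nth 0 lt_i).
Qed.

Lemma conj_part_eq0 (la : seq nat) (j : nat) :
  is_partition la -> part la 1 < j -> conj_part la j = 0.
Proof.
case: la => // a la /is_partition_cons[_ /allP ge_a] lt_aj.
apply/eqP; rewrite -leqn0 leqNgt -has_count; apply/hasPn => x.
rewrite -ltnNge inE => /predU1P[-> //|/ge_a xa].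
exact: leq_ltn_trans xa lt_aj.
Qed.

(** A new top row at least as long as the others moves each cell one row down and lengthens its
    column by one; the two shifts cancel in the hook length. *)
Lemma Hk_cons (a : nat) (la : seq nat) (h : nat) :
  all (geq a) la -> Hk la h -> Hk (a :: la) h.
Proof.
move=> ge_a [[|i] [j [/andP[// /andP[_ lt_i] /andP[j_gt0 le_j] ->]]]].
have le_ja := leq_trans le_j (part_le _ _ i.+1 ge_a).
exists i.+2, j; rewrite /is_cell /hook_length /conj_part /part /= in le_j *.
by rewrite ltnS lt_i j_gt0 le_j le_ja; split=> //; lia.
Qed.

(* The step at position [p] is the foot of column [j]: it comes after [j - 1]
   east steps and [size la - conj_part la j] north steps. *)
Lemma profile_East (la : seq nat) (p : nat) :
  is_partition la -> nth North (profile la) p = East ->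
  exists j, 0 < j <= part la 1 /\ p + conj_part la j = j.-1 + size la.
Proof.
elim: la p => [|a la IH] p pala /=; first by rewrite nth_nil.
have [pla ge_a] := is_partition_cons _ _ pala.
have := part_le _ _ 1 ge_a.
have := size_profile pla; rewrite /profile_length.
have hd : head 0 la = part la 1 by rewrite /part nth0.
rewrite hd nth_cat => szE le_a.
case: ltnP => [_ /(IH p pla)[j [/andP[j_gt0 le_j] pE]]|le_p].
  have le_ja := leq_trans le_j le_a.
  exists j; rewrite [part (a :: la) 1]/part /conj_part /= -/(conj_part la j).
  by rewrite j_gt0 le_ja; split=> //; lia.
rewrite nth_cat size_nseq; case: ltnP => [lt_p _|_]; last first.
  by case: (_ - _) => [|[|?]].
(* In the east run of the top row, all [size la] north steps of the lower rows are already behind,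
   so the other [p - size la] steps were east. *)
exists (p - size la).+1.
have c0 : conj_part la (p - size la).+1 = 0 by apply: conj_part_eq0 => //; lia.
rewrite [part (a :: la) 1]/part /conj_part /= -/(conj_part la _) c0.
have -> : p - size la < a by lia.
by split=> //; lia.
Qed.

(** Induction on rows: either [q] lies on the boundary of the lower rows, or it is the last step,
    the end of the top row, and the hook sits at the cell of row 1 above the foot [p]. *)
Lemma Hk_inversion (la : seq nat) (p q : nat) :
  is_partition la -> p < q < size (profile la) ->
  nth North (profile la) p = East -> nth East (profile la) q = North ->
  Hk la (q - p).
Proof.
elim: la => [|a la IH] pala; first by rewrite ltn0 andbF.
have [pla ge_a] := is_partition_cons _ _ pala.
move=> /andP[lt_pq lt_q] pE qN.
have [lt_qla|le_q] := ltnP q (size (profile la)).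
  apply: Hk_cons => //; apply: IH => //; first by rewrite lt_pq.
    by move: pE; rewrite /= nth_cat (ltn_trans lt_pq lt_qla).
  by move: qN; rewrite /= nth_cat lt_qla.
have qL : q.+1 = size (profile (a :: la)).
  move: qN lt_q; rewrite /= !size_cat size_nseq /= !nth_cat ltnNge le_q /=.
  by rewrite size_nseq nth_nseq; case: ltnP => // ? _ ?; lia.
have [j [/andP[j_gt0 le_j] pj]] := profile_East _ _ pala pE.
exists 1, j; rewrite /is_cell j_gt0 le_j; split=> //.
move: qL; rewrite (size_profile pala) /profile_length /hook_length => qL.
(* Keeps the truncated subtraction of the row index 1 exact. *)
have conj_gt0 : 0 < conj_part (a :: la) j.
  by rewrite /conj_part /=; move: le_j; rewrite /part /= => ->.
lia.
Qed.

Lemma count_East_North (w : seq step) :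
  count_mem East w + count_mem North w = size w.
Proof.
by rewrite -(count_predC (pred1 East)); congr (_ + _); apply: eq_count; case.
Qed.

(** With equal lengths, the two majorities give [u] more east steps than [v]; if every [East] of [u]
    faced an [East] of [v], the count would go the other way. *)
Lemma East_over_North (u v : seq step) :
  size u = size v -> count_mem North u < count_mem East u ->
  count_mem East v < count_mem North v ->
  exists p, [/\ p < size u, nth North u p = East & nth East v p = North].
Proof.
move=> suv uE vN.
have lt_vu : count_mem East v < count_mem East u.
  move: suv uE vN; rewrite -!count_East_North.
  move: (count_mem East u) (count_mem North u) (count_mem East v)
    (count_mem North v) => *; lia.
elim: u v suv lt_vu {uE vN} => [|x u IH] [|y v] //= [suv] lt_vu.
have [[-> ->]|le_xy] : (x = East /\ y = North) \/ (x == East) <= (y == East).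
- by case: x y {lt_vu} => [] []; auto.
- by exists 0.
have lt_vu' : count_mem East v < count_mem East u.
  by move: lt_vu le_xy; do 2!case: (_ == _) => /=; lia.
by have [p [lt_p uE vN]] := IH v suv lt_vu'; exists p.+1.
Qed.

Theorem theorem3 (la : seq nat) (hla : is_partition la) (hne : la <> [::]) :
  (forall s : nat, 0 < s -> s < profile_length la ->
     more_East_in_prefix la s -> more_North_in_suffix la s -> Hk la s) /\
  (forall S : set nat,
     (forall s : nat, S s ->
        [/\ 0 < s, more_East_in_prefix la s & more_North_in_suffix la s]) ->
     S `<=` Hk la).
Proof.
have hook s : 0 < s -> s < profile_length la ->
    more_East_in_prefix la s -> more_North_in_suffix la s -> Hk la s.
  move=> s_gt0 lt_s uE vN.
  have szL := size_profile hla.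
  have [|p []] := East_over_North _ _ _ uE vN.
    by rewrite size_drop size_takel szL ?leq_subr.
  rewrite size_takel ?szL ?leq_subr // => lt_p.
  rewrite nth_take // nth_drop => pE qN.
  rewrite -(addnK p s); apply: Hk_inversion => //.
  by rewrite szL; lia.
split=> // S hS s /hS[s_gt0 uE vN]; apply: hook => //.
(* For [s] at least the length of the profile, the prefix in (i) is empty and cannot have a strict
   majority. *)
rewrite ltnNge; apply/negP => le_s.
by move: uE; rewrite /more_East_in_prefix (eqP le_s) take0.
Qed.
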